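(* Let $X$ be a finite connected poset and $\varphi:I(X,\mathbb{Z}_2)\to I(X,\mathbb{Z}_2)$ a bijective additive map. Then $\varphi(E(I(X,\mathbb{Z}_2)))\subseteq E(I(X,\mathbb{Z}_2))$ if and only if $\varphi=\tau\circ\psi$ for some bijective shift map $\tau$ and some Lie automorphism $\psi$ of $I(X,\mathbb{Z}_2)$.
   Context: $I(X,\mathbb{Z}_2)$ is the incidence algebra of the locally finite poset $X$ over the two-element field: functions $f:X\times X\to\mathbb{Z}_2$ vanishing unless $x\le y$, with product $(fg)(x,y)=\sum_{x\le z\le y}f(x,z)g(z,y)$. A poset is connected if any two elements are joined by a finite sequence of elements in which consecutive elements are comparable. $E(A)$ denotes the idempotents of $A$. A shift map is an additive map $\tau:I(X,\mathbb{Z}_2)\to I(X,\mathbb{Z}_2)$ such that $\tau(f)-f$ lies in the center of $I(X,\mathbb{Z}_2)$ for all $f$. A Lie automorphism of $I(X,\mathbb{Z}_2)$ is a bijective additive map $\psi$ with $\psi(ab+ba)=\psi(a)\psi(b)+\psi(b)\psi(a)$ for all $a,b$. *)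

(* Defs.v *)
From HB Require Import structures.
From mathcomp Require Import all_boot all_order all_algebra.
Set Implicit Arguments. Unset Strict Implicit. Unset Printing Implicit Defensive.
Import Order.TTheory GRing.Theory.
Local Open Scope ring_scope.

Section Incidence.
Variables (d : Order.disp_t) (X : finPOrderType d).

Definition poset_connected : Prop :=
  forall x y : X, connect (fun a b : X => (a <= b)%O || (b <= a)%O) x y.

Definition inc_pred : {pred {ffun X * X -> 'F_2}} :=
  fun f => [forall p : X * X, (f p != 0) ==> (p.1 <= p.2)%O].

Lemma inc_zmod_closed : zmod_closed inc_pred.
Proof.
split.
  by apply/forallP=> p; rewrite ffunE eqxx.
move=> f g /forallP Hf /forallP Hg; apply/forallP=> p; rewrite !ffunE.
apply/implyP=> H; case: (boolP (p.1 <= p.2)%O) => // Hp.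
have /implyP Hf' := Hf p; have /implyP Hg' := Hg p.
have Ef : f p = 0 by apply/eqP; exact: (contraNT Hf' Hp).
have Eg : g p = 0 by apply/eqP; exact: (contraNT Hg' Hp).
by rewrite Ef Eg subrr eqxx in H.
Qed.

HB.instance Definition _ := GRing.isZmodClosed.Build _ inc_pred inc_zmod_closed.

Record incalg := IncAlg { incfun :> {ffun X * X -> 'F_2};
                          _ : incfun \in inc_pred }.

HB.instance Definition _ := [isSub for incfun].
HB.instance Definition _ := [Choice of incalg by <:].
HB.instance Definition _ := [SubChoice_isSubZmodule of incalg by <:].

Definition inc_mul_fun (f g : incalg) : {ffun X * X -> 'F_2} :=
  [ffun p : X * X => \sum_(z : X | (p.1 <= z)%O && (z <= p.2)%O) f (p.1, z) * g (z, p.2)].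

Lemma inc_mul_in (f g : incalg) : inc_mul_fun f g \in inc_pred.
Proof.
apply/forallP=> p; apply/implyP; rewrite ffunE; apply: contraNT => Hp.
rewrite big_pred0 // => z; apply/negbTE/negP => /andP [H1 H2].
by move: Hp; rewrite (le_trans H1 H2).
Qed.

Definition inc_mul (f g : incalg) : incalg := IncAlg (inc_mul_in f g).

Definition inc_idem (e : incalg) : Prop := inc_mul e e = e.

Definition inc_central (c : incalg) : Prop :=
  forall g : incalg, inc_mul c g = inc_mul g c.

Definition additive_map (f : incalg -> incalg) : Prop :=
  forall a b : incalg, f (a + b) = f a + f b.

Definition shift_map (tau : incalg -> incalg) : Prop :=
  additive_map tau /\ forall f : incalg, inc_central (tau f - f).

Definition lie_automorphism (psi : incalg -> incalg) : Prop :=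
  bijective psi /\ additive_map psi /\
  forall a b : incalg,
    psi (inc_mul a b + inc_mul b a) = inc_mul (psi a) (psi b) + inc_mul (psi b) (psi a).

End Incidence.

(* Main.v *)
Require Import Defs.
From HB Require Import structures.
From mathcomp Require Import all_boot all_order all_algebra.
Set Implicit Arguments. Unset Strict Implicit. Unset Printing Implicit Defensive.
Import Order.TTheory GRing.Theory.
Local Open Scope ring_scope.

(** Write [a, b] = ab + ba; the defect a^2 + a vanishes exactly on idempotents, has
    zero diagonal (entries lie in F_2), and [e, [e, x]] = [e^2, x].  Hence for a Lie
    automorphism psi and a shift tau the defect of tau (psi e) is central with zero
    diagonal whenever e is idempotent, i.e. it is 0.

    Conversely let phi preserve idempotents, and let psi be the additive map agreeing
    with phi on the e_xx and sending e_xy, x < y, to the defect of phi e_xy.  Feeding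
    idempotents such as e_xx + e_xy + e_xv to phi gives [phi a, phi b] = psi [a, b].
    By finiteness the inverse of phi also preserves idempotents, so psi is injective on
    brackets, and the Jacobi identity yields, for rho = phi^-1 psi,
      [rho [a, b], c] + [rho [b, c], a] + [rho [c, a], b] = 0.
    This makes rho e_xy equal to a diagonal element plus a multiple of e_xy, the
    diagonal being constant along every edge except possibly x < y.  If it were not
    constant along x < y as well, or if the multiple were 0, rho e_xy would be
    idempotent, so psi e_xy would be a nonzero idempotent with zero diagonal, which is
    impossible.  By connectedness rho f - f is always 0 or 1, so psi is the desired Lie
    automorphism and tau = phi psi^-1. *)

(** * Arithmetic in the two-element field *)

Lemma F2_cases (c : 'F_2) : c = 0 \/ c = 1.
Proof. by case: c => [[|[|m]] Hm] //; [left|right]; apply: val_inj. Qed.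

Lemma F2_addcc (c : 'F_2) : c + c = 0.
Proof. by case: (F2_cases c) => ->; apply/val_inj. Qed.

Lemma F2_mulcc (c : 'F_2) : c * c = c.
Proof. by case: (F2_cases c) => ->; apply/val_inj. Qed.

Ltac F2_brute :=
  repeat (let c := fresh "c" in intro c; case: (F2_cases c) => ->); apply/val_inj.

(** * The incidence algebra as a finite ring of characteristic two *)

Section IncidenceRing.
Variables (d : Order.disp_t) (X : finPOrderType d).
Implicit Types f g h : incalg X.

Lemma inc_ext f g : (forall u v : X, f (u, v) = g (u, v)) -> f = g.
Proof. by move=> H; apply/val_inj/ffunP => -[u v]; exact: H. Qed.

Lemma inc_out f (u v : X) : ~~ (u <= v)%O -> f (u, v) = 0.
Proof.
case: f => f /= /forallP /(_ (u, v)) /implyP H Huv.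
by apply/eqP; apply: contraNT Huv.
Qed.

Lemma inc_addE f g p : (f + g) p = f p + g p.
Proof. by rewrite [LHS]ffunE. Qed.

Lemma inc_zeroE p : (0 : incalg X) p = 0.
Proof. by rewrite [LHS]ffunE. Qed.

Lemma inc_sumE (I : finType) (P : pred I) (F : I -> incalg X) p :
  (\sum_(i | P i) F i) p = \sum_(i | P i) F i p.
Proof. by elim/big_rec2: _ => [|i a b _ <-]; rewrite ?inc_zeroE ?inc_addE. Qed.

Lemma inc_mul_sum f g (u v : X) :
  inc_mul f g (u, v) = \sum_(z : X) f (u, z) * g (z, v).
Proof.
rewrite ffunE /= big_mkcond /=; apply: eq_bigr => z _.
case: ifPn => //; rewrite negb_and => /orP[] H.
  by rewrite inc_out ?mul0r.
by rewrite (inc_out g) ?mulr0.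
Qed.

Lemma inc_one_in : [ffun p : X * X => ((p.1 == p.2)%:R : 'F_2)] \in @inc_pred d X.
Proof.
by apply/forallP => p; rewrite ffunE; case: (p.1 =P p.2) => [->|]; rewrite ?lexx
  ?eqxx // implybT.
Qed.

Definition inc_one : incalg X := IncAlg inc_one_in.

Lemma inc_mulA : associative (@inc_mul d X).
Proof.
move=> f g h; apply: inc_ext => u v; rewrite !inc_mul_sum.
under eq_bigr do rewrite inc_mul_sum mulr_sumr.
rewrite exchange_big /=; apply: eq_bigr => z _.
by rewrite inc_mul_sum mulr_suml; apply: eq_bigr => w _; rewrite mulrA.
Qed.

Lemma inc_mul1l : left_id inc_one (@inc_mul d X).
Proof.
move=> f; apply: inc_ext => u v; rewrite inc_mul_sum (bigD1 u) //= big1 => [|z Hz].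
  by rewrite ffunE eqxx mul1r addr0.
by rewrite ffunE /= eq_sym (negbTE Hz) mul0r.
Qed.

Lemma inc_mul1r : right_id inc_one (@inc_mul d X).
Proof.
move=> f; apply: inc_ext => u v; rewrite inc_mul_sum (bigD1 v) //= big1 => [|z Hz].
  by rewrite ffunE eqxx mulr1 addr0.
by rewrite ffunE /= (negbTE Hz) mulr0.
Qed.

Lemma inc_mulDl : left_distributive (@inc_mul d X) +%R.
Proof.
move=> f g h; apply: inc_ext => u v; rewrite inc_addE !inc_mul_sum -big_split.
by apply: eq_bigr => z _; rewrite inc_addE mulrDl.
Qed.

Lemma inc_mulDr : right_distributive (@inc_mul d X) +%R.
Proof.
move=> f g h; apply: inc_ext => u v; rewrite inc_addE !inc_mul_sum -big_split.
by apply: eq_bigr => z _; rewrite inc_addE mulrDr.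
Qed.

HB.instance Definition _ := GRing.Zmodule_isPzRing.Build (incalg X)
  inc_mulA inc_mul1l inc_mul1r inc_mulDl inc_mulDr.
(** Finiteness serves later to see that a preserver permutes the idempotents and that an injective
    [lie_part] is bijective. *)
HB.instance Definition _ := [Countable of incalg X by <:].
HB.instance Definition _ := [Finite of incalg X by <:].

Lemma inc_mulE f g (u v : X) : (f * g) (u, v) = \sum_(z : X) f (u, z) * g (z, v).
Proof. exact: inc_mul_sum. Qed.

(** By antisymmetry, only z = u lies between u and u. *)
Lemma inc_diag_mul f g (u : X) : (f * g) (u, u) = f (u, u) * g (u, u).
Proof.
rewrite inc_mulE (bigD1 u) //= big1 ?addr0 // => z Hz.
have [Huz|Huz] := boolP (u <= z)%O; last by rewrite inc_out ?mul0r.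
rewrite (inc_out g) ?mulr0 //; apply: contra Hz => Hzu.
by rewrite eq_le Hzu Huz.
Qed.

Lemma inc_oneE (u v : X) : (1 : incalg X) (u, v) = (u == v)%:R.
Proof. by rewrite [LHS]ffunE. Qed.

Lemma inc_addff f : f + f = 0.
Proof. by apply: inc_ext => u v; rewrite inc_addE inc_zeroE F2_addcc. Qed.

Lemma inc_oppff f : - f = f.
Proof. by apply/eqP; rewrite eq_sym -addr_eq0 inc_addff. Qed.

Lemma inc_addfK f g : f + g + g = f.
Proof. by rewrite -addrA inc_addff addr0. Qed.

Lemma inc_add_eq0 f g : f + g = 0 -> f = g.
Proof. by move/eqP; rewrite addr_eq0 inc_oppff => /eqP. Qed.

(** * Lie bracket and idempotency defect *)

Definition br f g := f * g + g * f.

Lemma brC f g : br f g = br g f.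
Proof. exact: addrC. Qed.

Lemma brff f : br f f = 0.
Proof. exact: inc_addff. Qed.

Lemma brDl f g h : br (f + g) h = br f h + br g h.
Proof. by rewrite /br mulrDl mulrDr addrACA. Qed.

Lemma brDr f g h : br h (f + g) = br h f + br h g.
Proof. by rewrite brC brDl !(brC h). Qed.

Lemma br0l f : br 0 f = 0.
Proof. by rewrite /br mul0r mulr0 addr0. Qed.

Lemma br0r f : br f 0 = 0.
Proof. by rewrite brC br0l. Qed.

Lemma br_jacobi f g h : br (br f g) h + br (br g h) f + br (br h f) g = 0.
Proof.
rewrite /br !mulrDl !mulrDr !mulrA.
apply: inc_ext => u v; rewrite !inc_addE inc_zeroE.
move: ((f * g * h) (u,v)) ((g * f * h) (u,v)) ((h * f * g) (u,v))
  ((h * g * f) (u,v)) ((g * h * f) (u,v)) ((f * h * g) (u,v)).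
by F2_brute.
Qed.

(** The mixed term f g f occurs twice and cancels. *)
Lemma br_br f g : br f (br f g) = br (f * f) g.
Proof.
rewrite /br !mulrDl !mulrDr !mulrA.
by rewrite addrA inc_addfK.
Qed.

Lemma br_diag f g (u : X) : br f g (u, u) = 0.
Proof. by rewrite inc_addE !inc_diag_mul mulrC F2_addcc. Qed.

Definition defect f := f * f + f.

Lemma defect_eq0 f : f * f = f -> defect f = 0.
Proof. by rewrite /defect => ->; exact: inc_addff. Qed.

(** The bracket is the polarization of squaring; this turns idempotency of sums into bracket
    identities. *)
Lemma defectD f g : defect (f + g) = defect f + defect g + br f g.
Proof.
rewrite /defect /br mulrDl !mulrDr.
apply: inc_ext => u v; rewrite !inc_addE.
move: (f (u,v)) (g (u,v)) ((f * g) (u,v)) ((g * f) (u,v)) ((f * f) (u,v)) ((g * g)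
  (u,v)).
by F2_brute.
Qed.

Lemma defect_diag f (u : X) : defect f (u, u) = 0.
Proof. by rewrite inc_addE inc_diag_mul F2_mulcc F2_addcc. Qed.

(** A zero diagonal makes f nilpotent, and a nilpotent idempotent is 0. Concretely, f = f^2
    expresses f(u, v) through f(u, z) with z < v, so induction on the number of z in [u, v)
    applies. *)
Lemma idem0diag f : f * f = f -> (forall u, f (u, u) = 0) -> f = 0.
Proof.
move=> Hf Hd; apply: inc_ext => u v; rewrite inc_zeroE.
have [n] := ubnP #|[set z | (z < v)%O & (u <= z)%O]|.
elim: n => // n IH in v * => Hn.
rewrite -Hf inc_mulE big1 // => z _.
have [Huz|Huz] := boolP (u <= z)%O; last by rewrite inc_out ?mul0r.
have [Hzv|Hzv] := boolP (z <= v)%O; last by rewrite (inc_out f Hzv) mulr0.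
have [->|Nzv] := eqVneq z v; first by rewrite Hd mulr0.
rewrite IH ?mul0r //; rewrite ltnS in Hn; apply: leq_trans Hn.
have Lzv : (z < v)%O by rewrite lt_neqAle Nzv.
apply: proper_card; apply/properP; split.
  apply/subsetP => w; rewrite !inE => /andP[Hw ->].
  by rewrite (lt_trans Hw Lzv).
by exists z; rewrite !inE ?ltxx ?Lzv ?Huz.
Qed.

Lemma additive0 (F : incalg X -> incalg X) : additive_map F -> F 0 = 0.
Proof. by move=> FD; rewrite -{1}(inc_addff 0) FD inc_addff. Qed.

(** With its mirror image, the source of all test idempotents below but one: an idempotent perturbed
    by a square-zero element of e A (1 + e). *)
Lemma idem_addl e f : e * e = e -> e * f = f -> f * e = 0 -> f * f = 0 ->
  (e + f) * (e + f) = e + f.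
Proof. by move=> ee ef fe ff; rewrite mulrDl !mulrDr ee ef fe ff !addr0. Qed.

Lemma idem_addr e f : e * e = e -> f * e = f -> e * f = 0 -> f * f = 0 ->
  (e + f) * (e + f) = e + f.
Proof. by move=> ee ef fe ff; rewrite mulrDl !mulrDr ee ef fe ff !addr0. Qed.

(** * Matrix units and central elements *)

Lemma delta_in (u v : X) :
  [ffun p : X * X => ([&& p.1 == u, p.2 == v & (u <= v)%O]%:R : 'F_2)]
    \in @inc_pred d X.
Proof.
apply/forallP => p; rewrite ffunE.
by case: (boolP [&& _, _ & _]) => [/and3P[/eqP-> /eqP-> ->]|_]; rewrite ?implybT ?eqxx.
Qed.

(** The matrix unit e_uv; it is [0] unless [u <= v]. *)
Definition delta (u v : X) : incalg X := IncAlg (delta_in u v).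

Lemma deltaE (u v a b : X) : (u <= v)%O -> delta u v (a, b) = (a == u)%:R * (b == v)%:R.
Proof. by move=> Huv; rewrite [LHS]ffunE /= Huv andbT; case: eqP => _; rewrite ?mul1r
  ?mul0r. Qed.

Lemma delta_mull (u v a b : X) f : (u <= v)%O ->
  (delta u v * f) (a, b) = (a == u)%:R * f (v, b).
Proof.
move=> Huv; rewrite inc_mulE (bigD1 v) //= big1 => [|z Hz].
  by rewrite deltaE // eqxx mulr1 addr0.
by rewrite deltaE // (negbTE Hz) mulr0 mul0r.
Qed.

Lemma delta_mulr (u v a b : X) f : (u <= v)%O ->
  (f * delta u v) (a, b) = f (a, u) * (b == v)%:R.
Proof.
move=> Huv; rewrite inc_mulE (bigD1 u) //= big1 => [|z Hz].
  by rewrite deltaE // eqxx mul1r addr0.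
by rewrite deltaE // (negbTE Hz) mul0r mulr0.
Qed.

Lemma br_deltaE (u v a b : X) f : (u <= v)%O ->
  br f (delta u v) (a, b) = f (a, u) * (b == v)%:R + (a == u)%:R * f (v, b).
Proof. by move=> Huv; rewrite inc_addE delta_mulr // delta_mull. Qed.

Lemma delta_mul (u v w z : X) : (u <= v)%O -> (w <= z)%O ->
  delta u v * delta w z = if v == w then delta u z else 0.
Proof.
move=> Huv Hwz; apply: inc_ext => a b; rewrite delta_mull // deltaE //.
case: (v =P w) => [Evw|_]; last by rewrite inc_zeroE mul0r mulr0.
by rewrite mul1r deltaE // (le_trans Huv) // Evw.
Qed.

Lemma delta_mul_comp (u v z : X) : (u <= v)%O -> (v <= z)%O ->
  delta u v * delta v z = delta u z.
Proof. by move=> Huv Hvz; rewrite delta_mul // eqxx. Qed.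

Lemma delta_mul0 (u v w z : X) : (u <= v)%O -> (w <= z)%O -> v != w ->
  delta u v * delta w z = 0.
Proof. by move=> Huv Hvz /negbTE H; rewrite delta_mul // H. Qed.

Lemma delta_sum f : f = \sum_(p : X * X | f p != 0) delta p.1 p.2.
Proof.
apply: inc_ext => u v.
rewrite inc_sumE; case: (F2_cases (f (u, v))) => Huv.
  rewrite Huv big1 // => -[a b] Hp /=.
  rewrite [LHS]ffunE /=; case: and3P => // -[/eqP Eu /eqP Ev _].
  by rewrite -Eu -Ev Huv eqxx in Hp.
have Luv : (u <= v)%O by apply: contraT => /(inc_out f); rewrite Huv.
rewrite (bigD1 (u, v)) ?Huv //= deltaE // !eqxx big1 ?mulr1 ?addr0 // => -[a b]
  /andP[_ Hp].
rewrite [LHS]ffunE /=; case: and3P => // -[/eqP Eu /eqP Ev _].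
by rewrite -Eu -Ev eqxx in Hp.
Qed.

(** Coefficients are 0 or 1, so matrix units generate the additive group and no scalars need to be
    treated. *)
Lemma inc_ind (P : incalg X -> Prop) :
  P 0 -> (forall f g, P f -> P g -> P (f + g)) ->
  (forall u v : X, (u <= v)%O -> P (delta u v)) -> forall f, P f.
Proof.
move=> P0 PD PE f; rewrite (delta_sum f); apply: big_ind => // -[u v] Hp; apply: PE.
by apply: contraNT Hp => /(inc_out f) ->.
Qed.

Lemma inc_one_sum : 1 = \sum_(x : X) delta x x.
Proof.
apply: inc_ext => u v.
rewrite inc_sumE inc_oneE (bigD1 u) //= big1 => [|z Hz].
  by rewrite deltaE // eqxx mul1r addr0 eq_sym.
by rewrite deltaE // eq_sym (negbTE Hz) mul0r.
Qed.

Lemma delta_idem (x : X) : delta x x * delta x x = delta x x.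
Proof. by rewrite delta_mul_comp. Qed.

Lemma delta_idem2 (x z : X) : x != z ->
  (delta x x + delta z z) * (delta x x + delta z z) = delta x x + delta z z.
Proof.
by move=> Nxz; rewrite mulrDl !mulrDr !delta_idem !delta_mul0 ?addr0 ?add0r // eq_sym.
Qed.

Lemma br_delta_lt (x y : X) : (x < y)%O -> br (delta x x) (delta x y) = delta x y.
Proof.
by move=> Lxy; have Wxy := ltW Lxy; rewrite /br delta_mul_comp // delta_mul0 ?addr0
  // gt_eqF.
Qed.

(** Commuting with e_vv kills the entries (u, v) with u != v. *)
Lemma central_diag0 (c : incalg X) :
  inc_central c -> (forall u, c (u, u) = 0) -> c = 0.
Proof.
move=> Hc c0; apply: inc_ext => u v; rewrite inc_zeroE.
have [->|Nuv] := eqVneq u v; first exact: c0.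
have : (c * delta v v) (u, v) = (delta v v * c) (u, v) by congr (incfun _ _); exact: Hc.
by rewrite delta_mulr // delta_mull // (negbTE Nuv) eqxx mulr1 mul0r.
Qed.

Lemma inc_centralP (c : incalg X) :
  inc_central c <-> forall f, br c f = 0.
Proof.
by split=> H f; [rewrite /br -[c * f]/(inc_mul c f) H inc_addff | exact/inc_add_eq0/H].
Qed.

End IncidenceRing.

(** * Brackets of images of matrix units under an idempotent preserver *)

Section Preserver.
Variables (d : Order.disp_t) (X : finPOrderType d) (phi : incalg X -> incalg X).
Hypothesis phiD : additive_map phi.
Hypothesis phi_idem : forall e, e * e = e -> phi e * phi e = phi e.
Implicit Types f g h e : incalg X.

Definition dphi f := defect (phi f).

(** If f and f + g are idempotent, this reads [dphi g] = [phi f, phi g], the pattern of the lemmas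
    that follow. *)
Lemma dphiD f g : dphi (f + g) = dphi f + dphi g + br (phi f) (phi g).
Proof. by rewrite /dphi phiD defectD. Qed.

Lemma dphi_idem e : e * e = e -> dphi e = 0.
Proof. by move=> He; rewrite /dphi defect_eq0 // phi_idem. Qed.

Lemma br_phi_xz (x z : X) : br (phi (delta x x)) (phi (delta z z)) = 0.
Proof.
have [->|Nxz] := eqVneq x z; first exact: brff.
by have := dphi_idem (delta_idem2 Nxz); rewrite dphiD !dphi_idem ?delta_idem // !add0r.
Qed.

Lemma br_phi_x_xy (x y : X) : (x < y)%O -> br (phi (delta x x)) (phi (delta x y)) =
  dphi (delta x y).
Proof.
move=> Lxy; have Wxy := ltW Lxy; have Nyx : y != x by rewrite gt_eqF.
have := @dphi_idem (delta x x + delta x y); rewrite dphiD (dphi_idem (delta_idem x))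
  add0r => H.
apply/esym/inc_add_eq0/H; apply: idem_addl; rewrite ?delta_idem ?delta_mul_comp //;
  exact: delta_mul0.
Qed.

Lemma br_phi_y_xy (x y : X) : (x < y)%O -> br (phi (delta y y)) (phi (delta x y)) =
  dphi (delta x y).
Proof.
move=> Lxy; have Wxy := ltW Lxy; have Nyx : y != x by rewrite gt_eqF.
have := @dphi_idem (delta y y + delta x y); rewrite dphiD (dphi_idem (delta_idem y))
  add0r => H.
apply/esym/inc_add_eq0/H; apply: idem_addr; rewrite ?delta_idem ?delta_mul_comp //;
  exact: delta_mul0.
Qed.

(** Test idempotent e_zz + e_xx + e_xy: the bracket of phi e_xx with phi e_xy cancels [dphi] of
    e_xy. *)
Lemma br_phi_z_xy (x y z : X) : (x < y)%O -> z != x -> z != y ->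
  br (phi (delta z z)) (phi (delta x y)) = 0.
Proof.
move=> Lxy Nzx Nzy; have Wxy := ltW Lxy; have Nyx : y != x by rewrite gt_eqF.
have := @dphi_idem (delta z z + delta x x + delta x y).
rewrite dphiD (dphi_idem (delta_idem2 Nzx)) add0r phiD brDl br_phi_x_xy //
  [br _ _ + _]addrC addrA inc_addff add0r.
apply; apply: idem_addl; first exact: delta_idem2.
- by rewrite mulrDl delta_mul0 ?add0r ?delta_mul_comp.
- by rewrite mulrDr !delta_mul0 ?addr0 // eq_sym.
- exact: delta_mul0.
Qed.

Lemma br_phi_xy_xv (x y v : X) : (x < y)%O -> (x < v)%O ->
  br (phi (delta x y)) (phi (delta x v)) = 0.
Proof.
move=> Lxy Lxv; have Wxy := ltW Lxy; have Wxv := ltW Lxv.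
have Nyx : y != x by rewrite gt_eqF.
have Nvx : v != x by rewrite gt_eqF.
have := @dphi_idem (delta x x + (delta x y + delta x v)).
rewrite dphiD (dphi_idem (delta_idem x)) add0r dphiD phiD brDr !br_phi_x_xy //
  [_ + br _ _]addrC inc_addfK.
apply; apply: idem_addl; rewrite ?delta_idem //.
- by rewrite mulrDr !delta_mul_comp.
- by rewrite mulrDl !delta_mul0 ?addr0.
- by rewrite mulrDl !mulrDr !delta_mul0 ?addr0.
Qed.

Lemma br_phi_xy_uy (x y u : X) : (x < y)%O -> (u < y)%O ->
  br (phi (delta x y)) (phi (delta u y)) = 0.
Proof.
move=> Lxy Luy; have Wxy := ltW Lxy; have Wuy := ltW Luy.
have Nyx : y != x by rewrite gt_eqF.
have Nyu : y != u by rewrite gt_eqF.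
have := @dphi_idem (delta y y + (delta x y + delta u y)).
rewrite dphiD (dphi_idem (delta_idem y)) add0r dphiD phiD brDr !br_phi_y_xy //
  [_ + br _ _]addrC inc_addfK.
apply; apply: idem_addr; rewrite ?delta_idem //.
- by rewrite mulrDl !delta_mul_comp.
- by rewrite mulrDr !delta_mul0 ?addr0.
- by rewrite mulrDl !mulrDr !delta_mul0 ?addr0.
Qed.

Lemma br_phi_xy_yv (x y v : X) : (x < y)%O -> (y < v)%O ->
  br (phi (delta x y)) (phi (delta y v)) = dphi (delta x v).
Proof.
move=> Lxy Lyv; have Lxv := lt_trans Lxy Lyv.
have Wxy := ltW Lxy; have Wyv := ltW Lyv; have Wxv := ltW Lxv.
have Nyx : y != x by rewrite gt_eqF.
have Nvy : v != y by rewrite gt_eqF.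
have Nvx : v != x by rewrite gt_eqF.
have Nyv : y != v by rewrite eq_sym.
have := @dphi_idem (delta y y + (delta x y + (delta y v + delta x v))).
rewrite dphiD (dphi_idem (delta_idem y)) add0r !phiD !brDr br_phi_y_xy // br_phi_x_xy //
  br_phi_z_xy // addr0.
rewrite dphiD dphiD !phiD brDr (br_phi_xy_xv Lxy Lxv) br_phi_xy_uy // !addr0.
set a := dphi _; set b := dphi (delta y v); set c := dphi (delta x v);
set s := br _ _ => H.
apply/inc_add_eq0; rewrite -{}H; last first.
  (* The test element factors as p q with p = e_yy + e_xy and q = e_yy + e_yv. Since q p = e_yy, it
     is idempotent: p q p q = p e_yy q = p q. *)
  have -> : delta y y + (delta x y + (delta y v + delta x v)) =
      (delta y y + delta x y) * (delta y y + delta y v).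
    by rewrite mulrDl !mulrDr !delta_mul_comp // addrACA -!addrA; congr (_ + _);
      rewrite addrCA.
  rewrite -mulrA [(delta y y + delta y v) * _]mulrA
    [(delta y y + delta y v) * (_ + _)]mulrDl !mulrDr.
  rewrite delta_idem (delta_mul0 Wyv) // (delta_mul0 Wyv Wxy Nvx) (delta_mul0 _ Wxy
    Nyx) // !addr0.
  by rewrite !delta_mul_comp.
move: a b c s => a b c s; apply: inc_ext => p q; rewrite !inc_addE.
by move: (a (p, q)) (b (p, q)) (c (p, q)) (s (p, q)); F2_brute.
Qed.

(** A common source or target is covered by the previous lemmas. Otherwise e_xx + e_uu + e_xy + e_uv
    is the test idempotent, and the cross brackets of its diagonal and off-diagonal units vanish. *)
Lemma br_phi_xy_uv (x y u v : X) : (x < y)%O -> (u < v)%O -> y != u -> v != x ->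
  br (phi (delta x y)) (phi (delta u v)) = 0.
Proof.
move=> Lxy Luv Nyu Nvx.
have [Exu|Nxu] := eqVneq x u.
  by move: Luv; rewrite -Exu => Lxv; exact: br_phi_xy_xv.
have [Eyv|Nyv] := eqVneq y v.
  by move: Luv; rewrite -Eyv => Luy; exact: br_phi_xy_uy.
have Wxy := ltW Lxy; have Wuv := ltW Luv.
have Nyx : y != x by rewrite gt_eqF.
have Nvu : v != u by rewrite gt_eqF.
have := @dphi_idem (delta x x + delta u u + (delta x y + delta u v)).
rewrite dphiD (dphi_idem (delta_idem2 Nxu)) add0r dphiD !phiD brDl !brDr !br_phi_x_xy //.
rewrite (@br_phi_z_xy u v x) // 1?eq_sym // (@br_phi_z_xy x y u) // 1?eq_sym //.
rewrite addr0 add0r [_ + br _ _]addrC inc_addfK.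
apply; apply: idem_addl; first exact: delta_idem2.
- by rewrite mulrDl !mulrDr !delta_mul_comp // !delta_mul0 ?addr0 ?add0r // eq_sym.
- by rewrite mulrDl !mulrDr !delta_mul0 ?addr0.
- by rewrite mulrDl !mulrDr !delta_mul0 ?addr0.
Qed.

(** * The additive map psi attached to phi *)

Definition lie_part_unit (p : X * X) : incalg X :=
  if p.1 == p.2 then phi (delta p.1 p.1) else dphi (delta p.1 p.2).

Definition lie_part f := \sum_(p | f p != 0) lie_part_unit p.

Lemma lie_partD : additive_map lie_part.
Proof.
move=> f g; rewrite /lie_part !(big_mkcond (fun p => _ p != 0)) -big_split.
apply: eq_bigr => p _ /=; rewrite inc_addE.
by case: (F2_cases (f p)) (F2_cases (g p)) => -> [] -> /=; rewrite ?addr0 ?add0r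
  ?inc_addff.
Qed.

Lemma lie_part_delta (u v : X) : (u <= v)%O ->
  lie_part (delta u v) = lie_part_unit (u, v).
Proof.
move=> Huv; rewrite /lie_part (bigD1 (u, v)) /=; last by rewrite deltaE // !eqxx.
rewrite big1 ?addr0 // => -[a b] /andP[].
by rewrite deltaE // xpair_eqE; case: (a == u); case: (b == v).
Qed.

Lemma lie_part_diag (x : X) : lie_part (delta x x) = phi (delta x x).
Proof. by rewrite lie_part_delta // /lie_part_unit eqxx. Qed.

Lemma lie_part_lt (x y : X) : (x < y)%O -> lie_part (delta x y) = dphi (delta x y).
Proof. by move=> Lxy; rewrite lie_part_delta ?ltW // /lie_part_unit lt_eqF. Qed.

Lemma lie_part0 : lie_part 0 = 0. Proof. exact: additive0 lie_partD. Qed.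

Lemma br_lie_part_delta (x y u v : X) : (x <= y)%O -> (u <= v)%O ->
  br (phi (delta x y)) (phi (delta u v)) = lie_part (br (delta x y) (delta u v)).
Proof.
(* A diagonal unit against a strict one; symmetry of the bracket gives the opposite order. *)
have aux (a b c : X) : (b < c)%O ->
    br (phi (delta a a)) (phi (delta b c)) = lie_part (br (delta a a) (delta b c)).
  move=> Lbc; have Wbc := ltW Lbc; have Ncb : c != b by rewrite gt_eqF.
  rewrite /br; have [->|Nab] := eqVneq a b.
    by rewrite delta_mul_comp // (delta_mul0 Wbc) // addr0 lie_part_lt // -br_phi_x_xy.
  have [->|Nac] := eqVneq a c.
    by rewrite delta_mul_comp // (delta_mul0 _ Wbc) // add0r lie_part_lt // -br_phi_y_xy.
  by rewrite !delta_mul0 // 1?eq_sym // addr0 lie_part0 -(br_phi_z_xy Lbc Nab Nac).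
move=> Wxy Wuv; have := Wxy; have := Wuv; rewrite !le_eqVlt.
case/predU1P => [Euv|Luv]; case/predU1P => [Exy|Lxy].
- rewrite -Euv -Exy br_phi_xz; have [->|Nxu] := eqVneq x u; first by rewrite brff lie_part0.
  by rewrite /br !delta_mul0 // 1?eq_sym // addr0 lie_part0.
- by rewrite -Euv brC aux // brC.
- by rewrite -Exy aux.
have [Eyu|Nyu] := eqVneq y u.
  rewrite -Eyu in Luv Wuv *; have Nvx : v != x by rewrite gt_eqF // (lt_trans Lxy).
  by rewrite br_phi_xy_yv // /br delta_mul_comp // delta_mul0 // addr0 lie_part_lt //
    (lt_trans Lxy).
have [Evx|Nvx] := eqVneq v x.
  rewrite Evx in Luv Wuv *.
  by rewrite brC br_phi_xy_yv // /br (delta_mul0 Wxy) // add0r delta_mul_comp //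
    lie_part_lt // (lt_trans Luv).
by rewrite br_phi_xy_uv // /br !delta_mul0 // addr0 lie_part0.
Qed.

(** Both sides are biadditive, so matrix units suffice. *)
Lemma br_lie_part f g : br (phi f) (phi g) = lie_part (br f g).
Proof.
have phi0 := additive0 phiD.
elim/inc_ind: f => [|f f' Hf Hf'|x y Wxy]; first by rewrite phi0 !br0l lie_part0.
  by rewrite phiD !brDl lie_partD Hf Hf'.
elim/inc_ind: g => [|g g' Hg Hg'|u v Wuv]; first by rewrite phi0 !br0r lie_part0.
  by rewrite phiD !brDr lie_partD Hg Hg'.
exact: br_lie_part_delta.
Qed.

End Preserver.

(** * Comparison of phi with psi through rho = phi^-1 psi *)

Section Inverse.
Variables (d : Order.disp_t) (X : finPOrderType d) (phi phi' : incalg X -> incalg X).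
Hypothesis phiD : additive_map phi.
Hypothesis phi_idem : forall e, e * e = e -> phi e * phi e = phi e.
Hypothesis phiK : cancel phi phi'.
Hypothesis phiK' : cancel phi' phi.
Implicit Types f g h e : incalg X.

Lemma additive_inv : additive_map phi'.
Proof. by move=> f g; apply: (can_inj phiK); rewrite phiD !phiK'. Qed.

(** An injective self-map of the finite set of idempotents is onto. *)
Lemma idem_preserver_inv e : e * e = e -> phi' e * phi' e = phi' e.
Proof.
move=> He; pose I := [set f : incalg X | f * f == f].
have sub : phi @: I \subset I.
  by apply/subsetP => _ /imsetP[f If ->]; move: If; rewrite !inE => /eqP /phi_idem/eqP.
have eqI : phi @: I = I.
  by apply/eqP; rewrite eqEcard sub card_imset ?leqnn //; exact: can_inj phiK.
have : e \in phi @: I by rewrite eqI inE He.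
by case/imsetP => f; rewrite inE => /eqP Hf Ee; rewrite Ee phiK.
Qed.

Notation psi := (lie_part phi).
Notation psi' := (lie_part phi').

(** Apply the bracket relation to [phi] and then to [phi']: [f, g] goes to [phi f, phi g] and
    back. *)
Lemma lie_partK_br f g : psi' (psi (br f g)) = br f g.
Proof.
by rewrite -(br_lie_part phiD phi_idem) -(br_lie_part additive_inv
  idem_preserver_inv) !phiK.
Qed.

Definition rho f := phi' (psi f).

Lemma rhoD : additive_map rho.
Proof. by move=> f g; rewrite /rho lie_partD additive_inv. Qed.

Lemma rho0 : rho 0 = 0. Proof. exact: additive0 rhoD. Qed.

Lemma phi_rho f : phi (rho f) = psi f. Proof. exact: phiK'. Qed.

(** Each summand is [psi'] of a double bracket of phi f, phi g, phi h, so this is the image of the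
    Jacobi identity under [psi']. *)
Lemma rho_jacobi f g h :
  br (rho (br f g)) h + br (rho (br g h)) f + br (rho (br h f)) g = 0.
Proof.
have bp := br_lie_part phiD phi_idem.
have brK f1 g1 h1 : br (rho (br f1 g1)) h1 = psi' (br (br (phi f1) (phi g1)) (phi h1)).
  by rewrite bp -phi_rho bp lie_partK_br.
by rewrite !brK -!lie_partD br_jacobi (additive0 (lie_partD phi')).
Qed.

Lemma rho_delta_br (x y : X) h : (x < y)%O ->
  br (rho (delta x y)) h =
    br (rho (br (delta x y) h)) (delta x x) + br (rho (br h (delta x x))) (delta x y).
Proof.
by move=> Lxy; apply/inc_add_eq0; rewrite addrA -{1}(br_delta_lt Lxy) rho_jacobi.
Qed.

(** For z outside {x, y}, e_zz commutes with e_xx and e_xy, hence with rho e_xy. A nonzero entry at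
    (u, v) therefore forces u and v into {x, y}. *)
Lemma rho_support (x y u v : X) : (x < y)%O -> (u < v)%O -> (u, v) != (x, y) ->
  rho (delta x y) (u, v) = 0.
Proof.
move=> Lxy Luv Nuv; have Wxy := ltW Lxy.
have Nvu : v != u by rewrite gt_eqF.
have comm z : z != x -> z != y -> br (rho (delta x y)) (delta z z) = 0.
  move=> Nzx Nzy; rewrite rho_delta_br // /br.
  by rewrite !delta_mul0 // 1?eq_sym // !addr0 rho0 !mul0r !mulr0 !addr0.
have inxy z : (rho (delta x y) (u, v) != 0) -> z \in [:: u; v] -> (z == x) || (z == y).
  move=> nz; rewrite !inE => zuv; apply: contraNT nz; rewrite negb_or => /andP[Nzx Nzy].
  have /(congr1 (fun f => f (u, v))) := comm z Nzx Nzy.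
  rewrite br_deltaE // inc_zeroE; case/orP: zuv => /eqP->.
    by rewrite (negbTE Nvu) eqxx mulr0 add0r mul1r => ->.
  by rewrite eq_sym (negbTE Nvu) eqxx mulr1 mul0r addr0 => ->.
apply/eqP; apply: contraT => nz.
have := inxy u nz; have := inxy v nz; rewrite !inE !eqxx orbT /= => /(_ isT) Hv /(_
  isT) Hu.
move: Hu Hv Nuv Luv; case/orP => /eqP->; case/orP => /eqP->.
- by rewrite ltxx.
- by rewrite eqxx.
- by rewrite lt_gtF.
- by rewrite ltxx.
Qed.

(** In [rho_delta_br] with h = e_uv, the (u, v) entry of the left side is the sum of the two
    diagonal values; the right side has to vanish there. *)
Lemma rho_diag_edge (x y u v : X) : (x < y)%O -> (u < v)%O -> (u, v) != (x, y) ->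
  rho (delta x y) (u, u) = rho (delta x y) (v, v).
Proof.
move=> Lxy Luv Nuv; have Wxy := ltW Lxy; have Wuv := ltW Luv.
have Nyx : y != x by rewrite gt_eqF.
have Nvu : v != u by rewrite gt_eqF.
have /(congr1 (fun f => f (u, v))) := rho_delta_br (delta u v) Lxy.
rewrite br_deltaE // [RHS]inc_addE !br_deltaE // !eqxx mulr1 mul1r.
suff -> : rho (br (delta x y) (delta u v)) (u, x) * (v == x)%:R +
       (u == x)%:R * rho (br (delta x y) (delta u v)) (x, v) +
       (rho (br (delta u v) (delta x x)) (u, x) * (v == y)%:R +
        (u == x)%:R * rho (br (delta u v) (delta x x)) (y, v)) = 0.
  by move: (rho _ _) (rho _ _) => a b; case: (F2_cases a) (F2_cases b) => -> [] ->.
(* For u = x what remains is the (y, v) entry of rho e_xv, which is off the support because y !=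
   x. *)
have [Eux|Nux] := eqVneq u x.
  subst u; have Nvy : v != y by apply: contraNneq Nuv => ->.
  rewrite (negbTE Nvu) (negbTE Nvy) !mulr0 !mul1r !add0r.
  rewrite {1}/br !delta_mul0 // addr0 rho0 inc_zeroE add0r brC br_delta_lt //.
  have [Lyv|] := boolP (y < v)%O; first by rewrite rho_support // xpair_eqE negb_and
    Nyx.
  rewrite lt_neqAle eq_sym Nvy /= => /inc_out; exact.
rewrite !mul0r !addr0.
(* For v = x what remains is the (u, x) entry of rho e_uy, again off the support. *)
have [Evx|Nvx] := eqVneq v x.
  subst v; rewrite (_ : (x == y) = false) 1?eq_sym ?(negbTE Nyx) // mulr0 addr0 mulr1.
  have Nyu : y != u by rewrite gt_eqF // (lt_trans Luv).
  rewrite /br delta_mul0 // add0r delta_mul_comp //; apply: rho_support => //.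
    exact: lt_trans Luv Lxy.
  by rewrite xpair_eqE negb_and orbC eq_sym Nyx.
by rewrite mulr0 add0r /br (delta_mul0 Wuv) // delta_mul0 1?eq_sym // addr0 rho0
  inc_zeroE mul0r.
Qed.

Lemma rho_not_idem (x y : X) : (x < y)%O ->
  rho (delta x y) * rho (delta x y) <> rho (delta x y).
Proof.
move=> Lxy /phi_idem; rewrite phi_rho => H.
have psi_br : psi (delta x y) = br (phi (delta x x)) (phi (delta x y)).
  by rewrite (br_lie_part phiD phi_idem) br_delta_lt.
have psi_xy0 : psi (delta x y) = 0.
  by apply: idem0diag => // u; rewrite psi_br br_diag.
(* As e_xy is itself a bracket, [psi'] recovers it from psi e_xy = 0, which is absurd. *)
have := lie_partK_br (delta x x) (delta x y); rewrite br_delta_lt // psi_xy0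
  (additive0 (lie_partD phi')).
move/(congr1 (fun f => f (x, y))); rewrite inc_zeroE deltaE ?ltW // !eqxx mulr1.
by move/eqP.
Qed.

Lemma rho_delta_edge (x y : X) : (x < y)%O ->
  rho (delta x y) (x, x) = rho (delta x y) (y, y) /\ rho (delta x y) (x, y) = 1.
Proof.
move=> Lxy; set r := rho (delta x y).
(* Over F_2 both claims together amount to this inequality; the corresponding equality is the (x, y)
   entry of r^2 = r. *)
suff H : r (x, y) * (r (x, x) + r (y, y)) != r (x, y).
  move: H; case: (F2_cases (r (x, y))) => ->; first by rewrite mul0r eqxx.
  by case: (F2_cases (r (x, x))) (F2_cases (r (y, y))) => -> [] ->.
apply/eqP => H; apply: (rho_not_idem Lxy); rewrite -/r.
apply: inc_ext => u v.
have [Luv|NLuv] := boolP (u < v)%O; last first.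
  have [->|Nuv] := eqVneq u v; first by rewrite inc_diag_mul F2_mulcc.
  have NWuv : ~~ (u <= v)%O by rewrite le_eqVlt negb_or Nuv.
  by rewrite !(@inc_out _ _ _ _ _ NWuv).
have Nvu : v != u by rewrite gt_eqF.
rewrite inc_mulE (bigD1 u) //= (bigD1 v) //= big1 => [|z /andP[Nzu Nzv]].
  rewrite addr0 [r (u, v) * _]mulrC [r (u, u) * _]mulrC [r (v, v) * _]mulrC -mulrDr.
  have [[-> ->] //|Nuv] := eqVneq (u, v) (x, y).
  by rewrite rho_support // mul0r.
have [Luz|] := boolP (u < z)%O; last first.
  by rewrite lt_neqAle eq_sym Nzu /= => /inc_out ->; rewrite mul0r.
have [Lzv|] := boolP (z < v)%O; last first.
  by rewrite lt_neqAle Nzv /= => /inc_out ->; rewrite mulr0.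
(* The consecutive edges u < z and z < v cannot both be x < y, so one factor is off the support. *)
have [[-> Ezy]|N1] := eqVneq (u, z) (x, y); last by rewrite rho_support ?mul0r.
by rewrite [X in _ * X]rho_support ?mulr0 // Ezy xpair_eqE negb_and gt_eqF.
Qed.

Hypothesis conn : poset_connected X.

Lemma rho_delta_const (x y u v : X) : (x < y)%O ->
  rho (delta x y) (u, u) = rho (delta x y) (v, v).
Proof.
move=> Lxy; set r := rho (delta x y).
have edge a b : (a <= b)%O -> r (a, a) = r (b, b).
  rewrite le_eqVlt => /predU1P[->//|Lab].
  have [[-> ->]|Nab] := eqVneq (a, b) (x, y); first by case: (rho_delta_edge Lxy).
  exact: rho_diag_edge.
have /connectP[p path_p ->] := conn u v.
elim: p u path_p => //= w p IH u /andP[uw path_p].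
by rewrite -(IH w path_p); case/orP: uw => /edge.
Qed.

(** {0, 1} is an additive subgroup, so matrix units suffice; the constant diagonal of rho e_xy
    decides between the two cases. *)
Lemma rho_shift f : rho f = f \/ rho f = f + 1.
Proof.
elim/inc_ind: f => [|f g Hf Hg|x y]; first by left; exact: rho0.
- rewrite rhoD; case: Hf Hg => -> [] ->; [by left|right|right|left].
  + by rewrite addrA.
  + by rewrite addrAC.
  + by rewrite addrACA inc_addff addr0.
rewrite le_eqVlt => /predU1P[->|Lxy].
  by left; rewrite /rho lie_part_diag phiK.
have Wxy := ltW Lxy; have [_ rxy] := rho_delta_edge Lxy.
have rE u v : rho (delta x y) (u, v) =
    delta x y (u, v) + rho (delta x y) (x, x) * (u == v)%:R.
  have [->|Nuv] := eqVneq u v.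
    rewrite (rho_delta_const v x Lxy) mulr1 deltaE //.
    have [->|_] := eqVneq v x; last by rewrite mul0r add0r.
    by rewrite (lt_eqF Lxy) mulr0 add0r.
  rewrite mulr0 addr0; have [[-> ->]|Nxy] := eqVneq (u, v) (x, y).
    by rewrite rxy deltaE // !eqxx mulr1.
  have -> : delta x y (u, v) = 0.
    by rewrite deltaE //; move: Nxy; rewrite xpair_eqE; do 2 case: (_ == _); rewrite
      ?mul0r ?mulr0.
  have [Luv|] := boolP (u < v)%O; first exact: rho_support.
  by rewrite lt_neqAle Nuv /= => /inc_out ->.
case: (F2_cases (rho (delta x y) (x, x))) => r0; [left|right];
  apply: inc_ext => u v; rewrite rE r0.
- by rewrite mul0r addr0.
- by rewrite mul1r inc_addE inc_oneE.
Qed.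

Lemma rho1 : rho 1 = 1.
Proof.
rewrite inc_one_sum (big_morph rho rhoD rho0); apply: eq_bigr => x _.
by rewrite /rho lie_part_diag phiK.
Qed.

(** By surjectivity of [phi], its value at 1 is central: [phi 1, phi g] = psi [1, g] = 0. Adding
    [phi 1] is thus invisible to brackets. *)
Lemma phi1_br f : br (phi 1) f = 0.
Proof.
by rewrite -[f]phiK' (br_lie_part phiD phi_idem) /br mul1r mulr1 inc_addff lie_part0.
Qed.

Lemma phi1_brr f : br f (phi 1) = 0.
Proof. by rewrite brC phi1_br. Qed.

Lemma lie_part_shift f : psi f = phi f \/ psi f = phi f + phi 1.
Proof.
by rewrite -phi_rho; case: (rho_shift f) => ->; rewrite ?phiD; [left|right].
Qed.

Lemma lie_part_automorphism : lie_automorphism psi.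
Proof.
split; last split; last 2 first.
- exact: lie_partD.
- move=> f g; rewrite -[LHS]/(psi (br f g)) -[RHS]/(br (psi f) (psi g)).
  rewrite -(br_lie_part phiD phi_idem).
  by case: (lie_part_shift f) (lie_part_shift g) => -> [] ->;
    rewrite ?(brDl, brDr, phi1_br, phi1_brr, addr0).
apply: injF_bij => f g; rewrite -!phi_rho => /(can_inj phiK) Hfg.
(* Since rho (f + g) is f + g or f + g + 1, the sum f + g is 0 or 1; the value 1 is excluded by rho
   1 = 1. *)
have H0 : rho (f + g) = 0 by rewrite rhoD Hfg inc_addff.
apply: inc_add_eq0; case: (rho_shift (f + g)); rewrite H0 // => /esym /inc_add_eq0 Efg.
by rewrite Efg -rho1 -Efg.
Qed.

End Inverse.

(** * The two directions of the equivalence *)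

Lemma lie_shift_idem (d : Order.disp_t) (X : finPOrderType d)
    (tau psi : incalg X -> incalg X) e :
  shift_map tau -> lie_automorphism psi -> e * e = e ->
  tau (psi e) * tau (psi e) = tau (psi e).
Proof.
move=> [_ tauc] [[psi' _ psiK'] [psiD psi_br]] He.
have Hbr f g : psi (br f g) = br (psi f) (psi g) by exact: psi_br.
have /inc_centralP Hc := tauc (psi e); set a := tau (psi e) in Hc *.
(* A central difference does not affect brackets. *)
have bra f : br a f = br (psi e) f.
  by apply/inc_add_eq0; rewrite -brDl -[X in a + X]inc_oppff Hc.
apply/inc_add_eq0/central_diag0; last exact: defect_diag.
(* The bracket of the defect of a with f is [a, [a, f]] + [a, f]. Replacing a by psi e and pulling
   back along psi reduces this to e^2 = e. *)
apply/inc_centralP => f; rewrite brDl -br_br !bra.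
by rewrite -[f]psiK' -!Hbr br_br He -psiD inc_addff (additive0 psiD).
Qed.

Theorem theorem5p20 (d : Order.disp_t) (X : finPOrderType d)
  (phi : incalg X -> incalg X) :
  poset_connected X -> bijective phi -> additive_map phi ->
  ((forall e : incalg X, inc_idem e -> inc_idem (phi e)) <->
   exists tau psi : incalg X -> incalg X,
     [/\ bijective tau, shift_map tau, lie_automorphism psi &
         forall f, phi f = tau (psi f)]).
Proof.
move=> conn [phi' phiK phiK'] phiD; split=> [phi_idem|]; last first.
  move=> [tau [psi [_ tau_shift psi_aut phiE]]] e He.
  by rewrite phiE; exact: (lie_shift_idem tau_shift psi_aut He).
have psi_aut := lie_part_automorphism phiD phi_idem phiK phiK' conn.
have [[psi' psiK psiK'] [psiD _]] := psi_aut.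
exists (phi \o psi'), (lie_part phi); split=> //.
- exact: bij_comp (Bijective phiK phiK') (Bijective psiK' psiK).
- split=> [f g|f] /=.
    by rewrite -[f]psiK' -[g]psiK' -psiD !psiK phiD.
  (* After substituting psi f for f, the difference is phi f - psi f, which is 0 or the central
     element [phi 1]. *)
  rewrite -{2}[f]psiK'; move: (psi' f) => {}f; rewrite inc_oppff; apply/inc_centralP
    => g.
  have := phi1_br phiD phi_idem phiK' g.
  case: (lie_part_shift phiD phi_idem phiK phiK' conn f) => ->.
    by rewrite inc_addff br0l.
  by rewrite addrA inc_addff add0r.
- by move=> f /=; rewrite psiK.
Qed.
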